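(* Let $\mathfrak{B}$ be a bornology with a compact base on a Tychonoff space $X$. The following are equivalent. (1) $X$ satisfies $S_1(\mathcal{O}_{\mathfrak{B}},\mathcal{O}_{\mathfrak{B}})$. (2) $C_{\mathfrak{B}}(X)$ has countable strong fan tightness. (3) $C_{\mathfrak{B}}(X)$ has countable strong fan tightness for finite sets.
   Context: A bornology $\mathfrak{B}$ on $X$ is a family of subsets of $X$ that is closed under taking subsets and finite unions and covers $X$; by standing convention $X\notin\mathfrak{B}$. A base of $\mathfrak{B}$ is a subfamily $\mathfrak{B}_0\subseteq\mathfrak{B}$ such that every $B\in\mathfrak{B}$ is contained in some $B_0\in\mathfrak{B}_0$; it is compact if its members are compact. $\mathcal{O}_{\mathfrak{B}}$ is the collection of all open $\mathfrak{B}$-covers of $X$: families $\mathcal{U}$ of open subsets of $X$ with $X\notin\mathcal{U}$ such that every $B\in\mathfrak{B}$ is contained in some $U\in\mathcal{U}$. $S_1(\mathcal{A},\mathcal{B})$ means that for each sequence $\{\mathcal{U}_n:n\in\omega\}$ of elements of $\mathcal{A}$ there are $V_n\in\mathcal{U}_n$ with $\{V_n:n\in\omega\}\in\mathcal{B}$. $C_{\mathfrak{B}}(X)$ is the set $C(X)$ of continuous real-valued functions on $X$ with the topology of uniform convergence on $\mathfrak{B}$, in which the sets $\{g\in C(X):|f(x)-g(x)|<\varepsilon\ \forall x\in B\}$ ($B\in\mathfrak{B}$, $\varepsilon>0$) form a neighbourhood base at $f$. For a space $Y$ and $y\in Y$, let $\Omega_y=\{C\subseteq Y:y\in\overline{C}\setminus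 C\}$. $Y$ has countable strong fan tightness if for every $y\in Y$ it satisfies $S_1(\Omega_y,\Omega_y)$. A family $\mathcal{C}$ of nonempty subsets of $Y$ is a $\pi$-network at $y$ if each neighbourhood of $y$ contains some member of $\mathcal{C}$. $Y$ has countable strong fan tightness for finite sets if for each $y\in Y$ and each sequence $\{\mathcal{C}_n:n\in\omega\}$ of $\pi$-networks at $y$ consisting of finite subsets of $Y$ there are $C_n\in\mathcal{C}_n$ such that $\{C_n:n\in\omega\}$ is a $\pi$-network at $y$. *)

(* Defs.v *)
From HB Require Import structures.
From mathcomp Require Import all_boot all_order all_algebra.
From mathcomp Require Import all_classical all_reals all_analysis.

Set Implicit Arguments.
Unset Strict Implicit.
Unset Printing Implicit Defensive.

Import Order.TTheory GRing.Theory Num.Theory.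
Import numFieldNormedType.Exports.

Local Open Scope classical_set_scope.
Local Open Scope ring_scope.

Definition tychonoff_space (X : topologicalType) : Prop :=
  completely_regular_space X /\ hausdorff_space X.

(* Closure under finite unions includes the empty union, hence [bornology0];
   [bornologyT] is the standing convention that the whole space is not
   bounded. *)
Record is_bornology (X : Type) (B : set (set X)) : Prop := IsBornology {
  bornologyS : forall C D, C `<=` D -> B D -> B C;
  bornology0 : B set0;
  bornologyU : forall C D, B C -> B D -> B (C `|` D);
  bornology_cover : \bigcup_(C in B) C = setT;
  bornologyT : ~ B setT }.

Definition is_bornology_base (X : Type) (B B0 : set (set X)) : Prop :=
  B0 `<=` B /\ forall C, B C -> exists2 D, B0 D & C `<=` D.

Definition has_compact_base (X : topologicalType) (B : set (set X)) : Prop :=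
  exists2 B0 : set (set X), is_bornology_base B B0 & B0 `<=` compact.

Definition open_covers (X : topologicalType) (B : set (set X)) :
    set (set (set X)) :=
  [set U | [/\ U `<=` open, ~ U setT &
               forall C, B C -> exists2 V, U V & C `<=` V]].

Definition S1 (T : Type) (A B : set (set T)) : Prop :=
  forall U : nat -> set T, (forall n, A (U n)) ->
    exists V : nat -> T, (forall n, U n (V n)) /\ B (range V).

(* The continuous real functions on X, as a subspace of the space of all
   functions with the topology of uniform convergence on the members of B. *)
Definition C_bornology (R : realType) (X : topologicalType)
    (B : set (set X)) : topologicalType :=
  initial_topology
    (fun f : continuousType X R => (f : X -> R) : {family B, X -> R}).

(* The sup topology used by {family B, X -> R} is only generated by the uniform
   neighbourhoods; closure of B under unions makes them a neighbourhood base. *)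
Lemma C_bornology_nbhsP (R : realType) (X : topologicalType)
    (B : set (set X)) (f : continuousType X R) (N : set (continuousType X R)) :
  is_bornology B ->
  nbhs (f : C_bornology R B) N <->
  exists C, B C /\ exists e : R, 0 < e /\
    [set g : continuousType X R | forall x, C x -> `|f x - g x| < e] `<=` N.
Proof.
move=> bB; split=> [|[C [BC [e [e0 sN]]]]].
  move=> /= [W [[Q oQ <-] /= Qf] sQN].
  pose G := filter_from [set p : set X * R | B p.1 /\ 0 < p.2]
    (fun p => [set g : X -> R | forall x, p.1 x -> `|f x - g x| < p.2]).
  have FG : Filter G.
    apply: filter_from_filter; first by exists (set0, 1); split => //=; case: bB.
    move=> [C e] [D d] [/= BC e0] [/= BD d0].
    exists (C `|` D, Num.min e d).
      by split; [exact: bornologyU | rewrite /= lt_min e0 d0].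
    move=> g /= gCD; split=> x xCD.
      by have := gCD x (or_introl xCD); rewrite lt_min => /andP[].
    by have := gCD x (or_intror xCD); rewrite lt_min => /andP[].
  have Gf : {family B, G --> (f : X -> R)}.
    apply/fam_cvgP => C BC P /uniform_nbhs[E [entE sEP]].
    move: entE; rewrite -entourage_ballE => -[e /= e0 seE].
    by exists (C, e) => // g /= gC; apply: sEP => x Cx; apply: seE; exact: gC.
  have /Gf[[C e] [/= BC e0] sQ] : nbhs ((f : X -> R) : {family B, X -> R}) Q.
    exact: open_nbhs_nbhs.
  exists C; split => //; exists e; split => // g gC.
  by apply: sQN; exact: sQ.
have fN : nbhs ((f : X -> R) : {family B, X -> R})
    [set g : X -> R | forall x, C x -> `|f x - g x| < e].
  apply: (@fam_nbhs X R B C [set xy | ball xy.1 e xy.2]) => //.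
  by rewrite -entourage_ballE; exists e.
have := @initial_continuous (continuousType X R) {family B, X -> R}
  (fun g => (g : X -> R)) f _ fN.
exact: (@filterS _ (nbhs (f : C_bornology R B)) _ _ _ sN).
Qed.

Definition Omega_at (Y : topologicalType) (y : Y) : set (set Y) :=
  [set C | (closure C `\` C) y].

Definition countable_strong_fan_tightness (Y : topologicalType) : Prop :=
  forall y : Y, S1 (Omega_at y) (Omega_at y).

Definition pi_network (Y : topologicalType) (y : Y) : set (set (set Y)) :=
  [set C | (forall A, C A -> A !=set0) /\
           forall N, nbhs y N -> exists2 A, C A & A `<=` N].

Definition countable_strong_fan_tightness_finite (Y : topologicalType) : Prop :=
  forall y : Y,
    S1 [set C | pi_network y C /\ C `<=` finite_set] (pi_network y).

(* Main.v *)
Require Import Defs.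
From mathcomp Require Import all_boot all_order all_algebra.
From mathcomp Require Import all_classical all_reals all_analysis.

(** Call [f] the function at which tightness is tested.

    From covers to functions: a finite set [A] of continuous functions and a
    tolerance [1/(n+1)] determine the open set of points where every member of
    [A] is less than [1/(n+1)] away from [f], and [A] lies in a basic
    neighbourhood of [f] given by [C] and [1/(n+1)] exactly when [C] is
    contained in that open set. So the [n]-th pi-network at [f] yields an open
    cover for the bornology (once the open sets are made proper by deleting
    points), and a selection among these covers comes from a selection [A n]
    among the networks. The selected sets [V n] catch each bounded set [C] for
    arbitrarily large [n] ([open_covers_infinitely_often]), hence also when
    [1/(n+1)] is below any given tolerance, so the [A n] form a pi-network
    ([S1_open_covers_tightness_finite]).

    Tightness for finite sets implies tightness in every space, since a set
    accumulating at a point gives the pi-network of its singletons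
    ([tightness_finiteW]).

    From functions to covers: attach to an open cover the continuous functions
    equal to 1 off some member of it. Complete regularity separates a compact
    set from a disjoint closed one, so, the bornology having a compact base, 0
    is in the closure of these functions. A selected function of absolute
    value less than 1 on [C] shows that [C] lies in the corresponding member
    of the cover ([tightness_S1_open_covers]). *)

Set Implicit Arguments.
Unset Strict Implicit.
Unset Printing Implicit Defensive.

Import Order.TTheory GRing.Theory Num.Theory.
Import numFieldNormedType.Exports.

Local Open Scope classical_set_scope.
Local Open Scope ring_scope.

(** Around each point of [K] half of an entourage keeps a whole neighbourhood
    away from [F]; compactness makes the entourage uniform over [K]. *)
Lemma compact_closed_uniform_separator (T : uniformType) (K F : set T) :
  compact K -> closed F -> K `&` F = set0 -> uniform_separator K F.
Proof.
move=> /compact_near_coveringP cK cF KF0; apply: uniform_separatorW.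
(* Near [G] means for all sufficiently small relations. *)
pose G := filter_from (@entourage T) (fun E => [set D | D `<=` E]).
have FG : Filter G.
  apply: filter_from_filter; first by exists setT; exact: filterT.
  move=> D E entD entE; exists (D `&` E); first exact: filterI.
  by move=> C sCDE; split=> xy /sCDE[].
have [x Kx|E entE sEF] := cK _ G (fun E x => forall z, E (x, z) -> ~ F z) FG.
  have : nbhs x (~` F).
    apply: open_nbhs_nbhs; split; first exact: closed_openC.
    by move=> Fx; have : (K `&` F) x by []; rewrite KF0.
  rewrite -nbhs_entourageE => -[E entE sEF].
  exists (xsection (split_ent E) x, [set D | D `<=` split_ent E]) => /=.
    by split; [exact: nbhs_entourage | exists (split_ent E)].
  move=> [y D] /= [/xsectionP Exy sD] z /sD Eyz; apply: sEF.
  by apply/xsectionP; exact: entourage_split Exy Eyz.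
exists E => //; rewrite -subset0 => -[x z] [[/= Kx Fz] Exz].
exact: sEF (@subset_refl _ E) _ Kx _ Exz Fz.
Qed.

(** A completely regular space carries a compatible uniformity, which reduces
    the claim to the uniform case. *)
Lemma compact_closed_separating_function (R : realType) (X : topologicalType)
    (K F : set X) :
  completely_regular_space X -> compact K -> closed F -> K `&` F = set0 ->
  exists f : continuousType X R,
    (forall x, K x -> f x = 0) /\ (forall x, F x -> f x = 1).
Proof.
move=> crX cK cF KF0.
pose X' := @completely_regular_uniformity.type R X crX.
have sKF : @uniform_separator X' K F by exact: compact_closed_uniform_separator.
have /(@uniform_separatorP X' R)[f [cf _ f0 f1]] := sKF.
exists (@mkcts X R f cf); split=> x Ax; [apply: f0 | apply: f1]; by exists x.
Qed.

Lemma open_finite_bigcap (T : topologicalType) (I : choiceType) (A : set I)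
    (F : I -> set T) :
  finite_set A -> (forall i, A i -> open (F i)) ->
  open (\bigcap_(i in A) F i).
Proof.
move=> fA oF; by rewrite -closedC setC_bigcap;
  apply: closed_bigcup => // i /oF; exact: open_closedC.
Qed.

Lemma open_continuous_dist_lt (R : realType) (X : topologicalType)
    (f g : continuousType X R) (e : R) : open [set x | `|f x - g x| < e].
Proof.
apply: (@open_comp _ _ (fun x => `|f x - g x|) [set r | r < e]).
  move=> x _; apply: cvg_norm; apply: cvgB; exact: cts_fun.
exact: open_lt.
Qed.

Lemma neq_setT_ex (T : Type) (A : set T) : A <> setT -> exists x, ~ A x.
Proof. by move=> /eqP/setTPn. Qed.

Section Bornology.
Variables (X : topologicalType) (B : set (set X)).
Hypothesis bB : is_bornology B.

Lemma bornology_set1 (x : X) : B [set x].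
Proof.
have : (\bigcup_(C in B) C) x by rewrite (bornology_cover bB).
by move=> [C BC Cx]; apply: bornologyS BC => // _ ->.
Qed.

(** Enlarge [C] by a point outside each of the first [N] sets: the result is
    still bounded, and whatever covers it comes later in the sequence. *)
Lemma open_covers_infinitely_often (V : nat -> set X) (C : set X) (N : nat) :
  open_covers B (range V) -> B C -> exists2 n, (N <= n)%N & C `<=` V n.
Proof.
move=> [_ VT covV] BC.
have VnT n : V n <> setT by move=> VnT; apply: VT; exists n.
have [D [BD CD DV]] : exists D, [/\ B D, C `<=` D &
    forall i, (i < N)%N -> ~ D `<=` V i].
  elim: N => [|N [D [BD CD DV]]]; first by exists C; split.
  have [x Vx] := neq_setT_ex (VnT N).
  exists (D `|` [set x]); split.
  - exact: bornologyU BD (bornology_set1 x).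
  - by move=> y /CD Dy; left.
  - move=> i; rewrite ltnS leq_eqVlt => /predU1P[->|iN] sDV.
      by apply: Vx; apply: sDV; right.
    by apply: (DV i iN) => y Dy; apply: sDV; left.
have [_ [n _ <-] DVn] := covV _ BD.
exists n; last exact: subset_trans DVn.
by rewrite leqNgt; apply/negP => /DV.
Qed.

(** The Hausdorff hypothesis makes points closed, which is used to keep the
    whole space out of the covers. *)
Lemma S1_open_covers_tightness_finite (R : realType) : hausdorff_space X ->
  S1 (open_covers B) (open_covers B) ->
  countable_strong_fan_tightness_finite (C_bornology R B).
Proof.
move=> hX s1 f CC piCC.
(* The functions of [A] may all be close to [f] on the whole space, which is
   not allowed in a cover; taking every proper open subset of the set of
   closeness avoids treating this case separately. *)
pose W n := [set V : set X | [/\ open V, V <> setT & exists2 A, CC n A &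
  forall g x, A g -> V x -> `|(f : X -> R) x - (g : X -> R) x| < n.+1%:R^-1]].
have covW n : open_covers B (W n).
  have [[_ netC] finC] := piCC n.
  split=> [V [] //|[_ //]|C BC].
  have [|A CA AC] := netC
    [set g : continuousType X R |
      forall x, C x -> `|(f : X -> R) x - g x| < n.+1%:R^-1].
    by apply/(C_bornology_nbhsP _ _ bB); exists C; split => //;
      exists n.+1%:R^-1; split.
  have [y Cy] : exists y, ~ C y.
    by apply: neq_setT_ex => CT; apply: (bornologyT bB); rewrite -CT.
  pose U := \bigcap_(g in A)
    [set x | `|(f : X -> R) x - (g : X -> R) x| < n.+1%:R^-1].
  (* Removing [y], a point outside [C], makes [U] proper. *)
  exists (U `&` ~` [set y]).
    split.
    - apply: openI.
        apply: open_finite_bigcap => [|g _]; first exact: finC.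
        exact: open_continuous_dist_lt.
      exact/closed_openC/accessible_closed_set1/hausdorff_accessible.
    - by move=> /seteqP[_ /(_ y I)] [_]; exact.
    - by exists A => // g x Ag [Ux _]; exact: Ux.
  move=> x Cx; split; last by move=> xy; apply: Cy; rewrite -xy.
  by move=> g Ag; exact: AC.
have [V [WV covV]] := s1 W covW.
have /choice[A HA] : forall n, exists A, CC n A /\
    forall g x, A g -> V n x ->
      `|(f : X -> R) x - (g : X -> R) x| < n.+1%:R^-1.
  by move=> n; have [_ _ [A ? ?]] := WV n; exists A.
exists A; split=> [n|]; first by case: (HA n).
split=> [_ [n _ <-]|N].
  by have [[ne _] _] := piCC n; apply: ne; case: (HA n).
move=> /(C_bornology_nbhsP _ _ bB)[C [BC [e [e0 sN]]]].
have [N0 _ N0e] : \forall n \near \oo, n.+1%:R^-1 < e :> R :=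
  near_infty_natSinv_lt (PosNum e0).
have [n N0n CVn] := open_covers_infinitely_often N0 covV BC.
exists (A n); first by exists n.
move=> g Ag; apply: sN => x Cx.
apply: lt_trans (N0e n N0n).
by case: (HA n) => _; apply=> //; exact: CVn.
Qed.

(** The compact base lets the bounded set be enlarged to a compact one before
    it is separated from the complement of a member of the cover. *)
Lemma tightness_S1_open_covers (R : realType) :
  completely_regular_space X -> has_compact_base B ->
  countable_strong_fan_tightness (C_bornology R B) ->
  S1 (open_covers B) (open_covers B).
Proof.
move=> crX [B0 [B0B baseB0] cB0] sft U covU.
pose z : continuousType X R := @mkcts X R (cst 0) (@cst_continuous X R 0).
pose A n := [set g : continuousType X R |
  exists2 V, U n V & forall x, ~ V x -> g x = 1].
have OmegaA n : Omega_at (z : C_bornology R B) (A n).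
  have [oU UT cU] := covU n; split=> [N|].
    move=> /(C_bornology_nbhsP _ _ bB)[C [BC [e [e0 sN]]]].
    have [K B0K CK] := baseB0 C BC.
    have [V UV KV] := cU K (B0B _ B0K).
    have [||| g [g0 g1]] :=
      @compact_closed_separating_function R X K (~` V) crX.
    - exact: cB0.
    - exact/open_closedC/oU.
    - by apply/disjoints_subset; rewrite setCK.
    exists g; split; first by exists V.
    by apply: sN => x /CK/g0 ->; rewrite subrr normr0.
  move=> [V UV V1].
  have [x /V1 /eqP] : exists x, ~ V x.
    by apply: neq_setT_ex => VT; apply: UT; rewrite -VT.
  by rewrite /z /= eq_sym oner_eq0.
have [g [Ag [clg _]]] := sft z A OmegaA.
have /choice[V HV] : forall n, exists V, U n V /\ forall x, ~ V x ->
    (g n : continuousType X R) x = 1.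
  by move=> n; have [V ? ?] := Ag n; exists V.
exists V; split=> [n|]; first by case: (HV n).
split=> [_ [n _ <-]|[n _ VT]|C BC].
- by have [oU _ _] := covU n; apply: oU; case: (HV n).
- by have [_ UT _] := covU n; apply: UT; rewrite -VT; case: (HV n).
have /clg[_ [[n _ <-] gC]] : nbhs (z : C_bornology R B)
    [set h : continuousType X R | forall x, C x -> `|z x - h x| < 1].
  by apply/(C_bornology_nbhsP _ _ bB); exists C; split => //; exists 1; split.
exists (V n); first by exists n.
move=> x Cx; apply: contrapT => Vx.
have := gC x Cx; have [_ /(_ x Vx) ->] := HV n.
by rewrite /z /= sub0r normrN normr1 ltxx.
Qed.

End Bornology.

Lemma tightness_finiteW (Y : topologicalType) :
  countable_strong_fan_tightness_finite Y -> countable_strong_fan_tightness Y.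
Proof.
move=> sftf y A OA.
have [] := sftf y (fun n => set1 @` A n).
  move=> n; have [clA _] := OA n; split; last by move=> _ [g _ <-].
  split=> [_ [g _ <-]|N /clA[g [Ag Ng]]]; first by exists g.
  by exists [set g]; [exists g | move=> _ ->].
move=> S [AS [_ netS]].
have /choice[g Hg] : forall n, exists g, A n g /\ S n = [set g].
  by move=> n; have [g ? ?] := AS n; exists g.
exists g; split=> [n|]; first by case: (Hg n).
split=> [N /netS[_ [n _ <-]]|[n _ gy]].
  by have [_ ->] := Hg n => sN; exists (g n); split; [exists n | exact: sN].
by have [_] := OA n; apply; rewrite -gy; case: (Hg n).
Qed.

Theorem theorem5p10 (R : realType) (X : topologicalType) (B : set (set X)) :
  tychonoff_space X -> is_bornology B -> has_compact_base B ->
  [<-> S1 (open_covers B) (open_covers B);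
       countable_strong_fan_tightness (C_bornology R B);
       countable_strong_fan_tightness_finite (C_bornology R B)].
Proof.
move=> [crX hX] bB cbB.
have s13 := @S1_open_covers_tightness_finite X B bB R hX.
have s21 := @tightness_S1_open_covers X B bB R crX cbB.
have s32 := @tightness_finiteW (C_bornology R B).
tfae; [by move/s13/s32 | by move/s21/s13 | by move/s32/s21].
Qed.
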